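(* Let $\mathbf{x}=\begin{bmatrix}x_1&x_2&x_3&x_4\end{bmatrix}$ be a row vector with complex entries, let $P,Q,R\in\mathcal{P}_4$, and let $A=A(\mathbf{x};P,Q,R)$ be the $4\times 4$ matrix whose rows are, in order, $\mathbf{x},\ \mathbf{x}P,\ \mathbf{x}Q,\ \mathbf{x}R$. Then $A$ is an orthogonal permutative matrix (OPM) if and only if $A\in\mathcal{X}\cup\mathcal{Y}\cup\mathcal{Z}$, where $$\mathcal{X}=\left\{\overline{P}M^{\pm}_{x,z},\ \overline{P}N^{\pm}_{z,x} : x^2+z^2\mp z=0,\ x,z\in\mathbb{C},\ \overline{P}\in 1\oplus\mathcal{P}_3\right\},$$ $$\mathcal{Y}=\left\{\overline{P}P_{(23)}M^{\pm}_{x,z}P_{(23)},\ \overline{P}P_{(23)}N^{\pm}_{z,x}P_{(23)} : x^2+z^2\mp z=0,\ x,z\in\mathbb{C},\ \overline{P}\in 1\oplus\mathcal{P}_3\right\},$$ $$\mathcal{Z}=\left\{\overline{P}P_{(24)}M^{\pm}_{x,z}P_{(24)},\ \overline{P}P_{(24)}N^{\pm}_{z,x}P_{(24)} : x^2+z^2\mp z=0,\ x,z\in\mathbb{C},\ \overline{P}\in 1\oplus\mathcal{P}_3\right\}.$$ Here upper signs go together and lower signs go together (superscript $+$ with $x^2+z^2-z=0$, superscript $-$ with $x^2+z^2+z=0$).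
   Context: $\mathcal{P}_n$ is the group of $n\times n$ permutation matrices; for a permutation $\sigma$, $P_\sigma$ is the matrix with $(i,j)$ entry $1$ if $\sigma(i)=j$ and $0$ otherwise. $1\oplus\mathcal{P}_3=\left\{\begin{bmatrix}1&\mathbf{0}^T\\ \mathbf{0}&P\end{bmatrix}: P\in\mathcal{P}_3\right\}\subset\mathcal{P}_4$. A matrix is permutative if each of its rows is a permutation of any other row. An orthogonal permutative matrix (OPM) is a permutative complex matrix $A$ with $A^TA=I$. Notation, for complex $t,x,z$ and a sign $\pm$: $$A_t=\begin{bmatrix}t&-t\\-t&t\end{bmatrix},\quad B^{\pm}_t=\begin{bmatrix}t&\pm1-t\\ \pm1-t&t\end{bmatrix},\quad F=\begin{bmatrix}0&1\\1&0\end{bmatrix},$$ $$M^{\pm}_{x,z}=\begin{bmatrix}A_x&B^{\pm}_z\\ B^{\pm}_z&-A_x\end{bmatrix},\quad N^{\pm}_{x,z}=\begin{bmatrix}B^{\pm}_x&A_z\\ A_z&FB^{\pm}_x\end{bmatrix}$$ (so $N^{\pm}_{z,x}$ has diagonal blocks $B^{\pm}_z$, $FB^{\pm}_z$ and off-diagonal blocks $A_x$). *)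

(* Defs.v *)
From mathcomp Require Import all_boot all_fingroup all_algebra.
From mathcomp Require Import classical_sets reals complex.

Set Implicit Arguments.
Unset Strict Implicit.
Unset Printing Implicit Defensive.

Import GRing.Theory.

Local Open Scope ring_scope.
Local Open Scope classical_set_scope.

Definition permutative (T : Type) (n : nat) (A : 'M[T]_n) : Prop :=
  forall i j : 'I_n, exists s : 'S_n, row i A = col_perm s (row j A).

(* The transpose is not conjugated: for complex entries this is orthogonality,
   not unitarity. *)
Definition OPM (C : nzRingType) (n : nat) (A : 'M[C]_n) : Prop :=
  permutative A /\ A^T *m A = 1%:M.

Definition mxrows4 (C : nzRingType) (x : 'rV[C]_4) (P Q R : 'M[C]_4) : 'M[C]_4 :=
  \matrix_(i < 4) nth 0 [:: x; x *m P; x *m Q; x *m R] i.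

Section Blocks.
Variable C : nzRingType.
Implicit Types t x z : C.

Definition Amx t : 'M[C]_2 := \matrix_(i < 2, j < 2) (if i == j then t else - t).

(* Signs are encoded as booleans: (-1) ^+ false = 1 is the upper sign and
   (-1) ^+ true = -1 the lower one. *)
Definition Bmx (s : bool) t : 'M[C]_2 :=
  \matrix_(i < 2, j < 2) (if i == j then t else (-1) ^+ s - t).

Definition Fmx : 'M[C]_2 := \matrix_(i < 2, j < 2) (if i == j then 0 else 1).

Definition Mmx (s : bool) x z : 'M[C]_4 :=
  (block_mx (Amx x) (Bmx s z) (Bmx s z) (- Amx x) : 'M[C]_(2 + 2)).

Definition Nmx (s : bool) x z : 'M[C]_4 :=
  (block_mx (Bmx s x) (Amx z) (Amx z) (Fmx *m Bmx s x) : 'M[C]_(2 + 2)).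

Definition one_oplus_P3 : set 'M[C]_4 :=
  [set Pb | exists2 P : 'M[C]_3,
     is_perm_mx P & Pb = (block_mx 1%:M 0 0 P : 'M[C]_(1 + 3))].

(* Indices are 0-based, so the transpositions (23) and (24) exchange the
   ordinals 1, 2 and 1, 3 respectively. *)
Definition P23 : 'M[C]_4 := tperm_mx (inord 1) (inord 2).
Definition P24 : 'M[C]_4 := tperm_mx (inord 1) (inord 3).

Definition calX : set 'M[C]_4 :=
  [set A | exists (Pb : 'M[C]_4) (s : bool) (x z : C),
     [/\ one_oplus_P3 Pb,
         x ^+ 2 + z ^+ 2 - (-1) ^+ s * z = 0
       & A = Pb *m Mmx s x z \/ A = Pb *m Nmx s z x]].

Definition calY : set 'M[C]_4 :=
  [set A | exists (Pb : 'M[C]_4) (s : bool) (x z : C),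
     [/\ one_oplus_P3 Pb,
         x ^+ 2 + z ^+ 2 - (-1) ^+ s * z = 0
       & A = Pb *m P23 *m Mmx s x z *m P23 \/
         A = Pb *m P23 *m Nmx s z x *m P23]].

Definition calZ : set 'M[C]_4 :=
  [set A | exists (Pb : 'M[C]_4) (s : bool) (x z : C),
     [/\ one_oplus_P3 Pb,
         x ^+ 2 + z ^+ 2 - (-1) ^+ s * z = 0
       & A = Pb *m P24 *m Mmx s x z *m P24 \/
         A = Pb *m P24 *m Nmx s z x *m P24]].

End Blocks.

Arguments one_oplus_P3 C : clear implicits.
Arguments calX C : clear implicits.
Arguments calY C : clear implicits.
Arguments calZ C : clear implicits.

(* Main.v *)
(** Write s = x_1 + ... + x_4.  Orthogonality of A gives s^2 = 1 and
    x_1^2 + ... + x_4^2 = 1.  If r is the permutation relating two rows of A,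
    the vanishing of their inner product, sum_u x_u x_(r u) = 0, factors:
    - r = (i j):  (x_i - x_j)^2 = 1;
    - r a 3-cycle fixing i:  x_i (2 x_i - s) = 0;
    - r = (i j)(k l), or a 4-cycle of square (i j)(k l):
      (x_i + x_j) (x_k + x_l) = 0.
    A few combinations of these conditions are contradictory or force three of
    the x_u to coincide.  A finite check over all triples of permutations shows
    that in every other case the four rows are the translates of x under one of
    the three cyclic subgroups of order 4 in S_4, one for each of the sets X, Y
    and Z; the vanishing factor selects M or N.  When three coordinates
    coincide, the rows are also translates of x under any of these subgroups,
    since each is transitive. *)

Require Import Defs.
From mathcomp Require Import all_boot all_fingroup all_algebra.
From mathcomp Require Import classical_sets reals complex.
From mathcomp Require Import ring zify.

Set Implicit Arguments.
Unset Strict Implicit.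
Unset Printing Implicit Defensive.

Import GRing.Theory Num.Theory.

Local Open Scope ring_scope.
Local Open Scope classical_set_scope.
Local Open Scope complex_scope.

(** * Relative permutations of rows, and the finite check on triples *)

Definition perms4 : seq (seq nat) := permutations (iota 0 4).

(* The permutation sending p_j to q_j, for one-line notations p and q. *)
Definition rel_perm (p q : seq nat) : seq nat :=
  [seq nth 0%N q (index u p) | u <- iota 0 4].

Definition acts (r : seq nat) (i j k l : nat) (im : seq nat) : bool :=
  [seq nth 0%N r u | u <- [:: i; j; k; l]] == im.

Definition is_id i j k l r := acts r i j k l [:: i; j; k; l].
Definition is_transp i j k l r := acts r i j k l [:: j; i; k; l].
Definition is_cycle3 i j k l r := acts r i j k l [:: i; k; l; j].

(* The nontrivial elements of the cyclic group of order 4 whose element of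
   order 2 is (i j)(k l). *)
Definition is_cyclic i j k l r :=
  [|| acts r i j k l [:: j; i; l; k], acts r i j k l [:: k; l; j; i]
    | acts r i j k l [:: l; k; i; j]].

(* Types of relative permutations that cannot occur together unless three
   coordinates of x coincide; the last line is a triangle or a star of
   transpositions. *)
Definition conflict_at (rs : seq (seq nat)) i j k l :=
  [|| has (is_id i j k l) rs,
      has (is_cyclic i j k l) rs &&
      [|| has (is_cyclic i k j l) rs, has (is_cycle3 i j k l) rs
        | has (is_transp i j k l) rs]
    | has (is_transp i j k l) rs && has (is_transp i k j l) rs &&
      (has (is_transp j k i l) rs || has (is_transp i l j k) rs)].

Definition conflict rs :=
  has (fun s => if s is [:: i; j; k; l] then conflict_at rs i j k l else false)
      perms4.

(** The quadruples are the one-line notations of the identity and of the transpositions behind [P23]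
    and [P24], so the alternatives lead to [calX], [calY] and [calZ] in turn. *)
Definition same_cyclic rs :=
  [|| all (is_cyclic 0 1 2 3) rs, all (is_cyclic 0 2 1 3) rs
    | all (is_cyclic 0 3 2 1) rs].

(** Row 0 carries the identity, so [p], [q], [r] are themselves relative permutations; with the
    other three they cover all six pairs of rows. *)
Lemma conflict_or_same_cyclic :
  all (fun p => all (fun q => all (fun r =>
    conflict [:: p; q; r; rel_perm p q; rel_perm p r; rel_perm q r]
    || same_cyclic [:: p; q; r]) perms4) perms4) perms4.
Proof. by lazy. Qed.

(** Certificate principle: once the coefficients are supplied, [ring] or [field] verifies the
    remaining identity. *)
Lemma linear_combination2 (R : pzRingType) (a a' b b' : R) :
  a = a' -> b = b' -> forall c d x x',
  x - x' = c * (a - a') + d * (b - b') -> x = x'.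
Proof. by move=> -> -> c d x x'; rewrite !subrr !mulr0 addr0 => /subr0_eq. Qed.

Lemma linear_combination3 (R : pzRingType) (a a' b b' f f' : R) :
  a = a' -> b = b' -> f = f' -> forall c d e x x',
  x - x' = c * (a - a') + d * (b - b') + e * (f - f') -> x = x'.
Proof.
by move=> -> -> -> c d e x x'; rewrite !subrr !mulr0 !addr0 => /subr0_eq.
Qed.

Arguments linear_combination2 {R a a' b b'} _ _ c d {x x'} _.
Arguments linear_combination3 {R a a' b b' f f'} _ _ _ c d e {x x'} _.

(** * Quadratic relations among the coordinates, and their conflicts *)

Section Coordinates.
Variables (F : numFieldType) (y : nat -> F) (s : F).
Hypothesis sum_y : \sum_(u <- iota 0 4) y u = s.
Hypothesis sum_sqr_y : \sum_(u <- iota 0 4) y u ^+ 2 = 1.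
Hypothesis sqr_s : s ^+ 2 = 1.

Definition autocorr (r : seq nat) : F :=
  \sum_(u <- iota 0 4) y u * y (nth 0%N r u).

Definition three_equal : Prop :=
  exists2 m, (m < 4)%N & exists c, forall u, (u < 4)%N -> u != m -> y u = c.

Section Relabelled.
Variables i j k l : nat.
Hypothesis ijkl : perm_eq [:: i; j; k; l] (iota 0 4).

Lemma sum4 (f : nat -> F) : \sum_(u <- iota 0 4) f u = f i + f j + f k + f l.
Proof. by rewrite -(perm_big _ ijkl) /= !big_cons big_nil addr0 !addrA. Qed.

Lemma sum_yE : y i + y j + y k + y l = s.
Proof. by rewrite -sum_y sum4. Qed.

Lemma sum_sqr_yE : y i ^+ 2 + y j ^+ 2 + y k ^+ 2 + y l ^+ 2 = 1.
Proof. by rewrite -sum_sqr_y sum4. Qed.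

(** Half the difference of [s ^+ 2] and the sum of squares, both equal to 1. *)
Lemma sum_pairs_y :
  y i * y j + y i * y k + y i * y l + y j * y k + y j * y l + y k * y l = 0.
Proof.
by apply: (linear_combination2 sqr_s sum_sqr_yE (1 / 2) (- 1 / 2));
  rewrite -sum_yE; field.
Qed.

Lemma three_equalW : y i = y j -> y j = y k -> three_equal.
Proof.
move=> yij yjk; have: l \in iota 0 4 by rewrite -(perm_mem ijkl) !inE eqxx !orbT.
rewrite mem_iota => l4; exists l => //; exists (y k) => u u4 /negPf ul.
have: u \in iota 0 4 by rewrite mem_iota.
by rewrite -(perm_mem ijkl) !inE ul orbF => /or3P[] /eqP ->; rewrite ?yij.
Qed.

Lemma autocorr_acts r a b c d : acts r i j k l [:: a; b; c; d] ->
  autocorr r = y i * y a + y j * y b + y k * y c + y l * y d.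
Proof. by rewrite /autocorr sum4 => /eqP[-> -> -> ->]. Qed.

Lemma autocorr_id r : is_id i j k l r -> autocorr r = 1.
Proof. by move=> /autocorr_acts ->; rewrite -!expr2 sum_sqr_yE. Qed.

Lemma autocorr_transp r : is_transp i j k l r -> autocorr r = 0 ->
  (y i - y j) ^+ 2 = 1.
Proof.
move=> /autocorr_acts -> T0.
by apply: (linear_combination2 sum_sqr_yE T0 1 (-1)); ring.
Qed.

(** Subtracting the sum over pairs from the autocorrelation leaves
    [y i ^+ 2 - y i * (y j + y k + y l)]. *)
Lemma autocorr_cycle3 r : is_cycle3 i j k l r -> autocorr r = 0 ->
  y i * (2 * y i - s) = 0.
Proof.
move=> /autocorr_acts -> T0.
by apply: (linear_combination2 T0 sum_pairs_y 1 (-1)); rewrite -sum_yE; ring.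
Qed.

(** For the two 4-cycles the autocorrelation is this product; for the involution, half of it is
    subtracted from the sum over pairs. *)
Lemma autocorr_cyclic r : is_cyclic i j k l r -> autocorr r = 0 ->
  (y i + y j) * (y k + y l) = 0.
Proof.
case/or3P => /autocorr_acts -> T0; last 2 first.
- by rewrite -T0; ring.
- by rewrite -T0; ring.
by apply: (linear_combination2 sum_pairs_y T0 1 (-1 / 2)); field.
Qed.

Lemma pair_products_y : (y i + y j) * (y k + y l) = 0 ->
  y i * y j + y k * y l = 0.
Proof.
by move=> D; apply: (linear_combination2 sum_pairs_y D 1 (-1)); ring.
Qed.

(** The equations give [2 * (u * v) = 1]; squaring yields 4 = 1, excluded in characteristic 0. *)
Lemma triangle_transp : (y i - y j) ^+ 2 = 1 -> (y i - y k) ^+ 2 = 1 ->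
  (y j - y k) ^+ 2 = 1 -> False.
Proof.
set u := y i - y j; set v := y i - y k => u1 v1.
rewrite (_ : y j - y k = v - u); last by rewrite /u /v; ring.
move=> uv1; have uv : 2 * (u * v) = 1.
  by apply: (linear_combination3 u1 v1 uv1 1 1 (-1)); ring.
have: (3 : F) = 0; last by apply/eqP; rewrite pnatr_eq0.
by apply: (linear_combination3 u1 v1 uv (- 4 * v ^+ 2) (-4) (2 * (u * v) + 1)); ring.
Qed.

(** Here [s = 4 * y i - u], and four times the sum of squares minus [s ^+ 2] is [11 * u ^+ 2], so 3
    = 11. *)
Lemma no_unbalanced_star u : u ^+ 2 = 1 ->
  y j = y i - u -> y k = y i - u -> y l = y i + u -> False.
Proof.
move=> u1 yj yk yl; have: (8 : F) = 0; last by apply/eqP; rewrite pnatr_eq0.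
apply: (linear_combination3 u1 sum_sqr_yE sqr_s (-11) 4 (-1)).
by rewrite -sum_yE yj yk yl; ring.
Qed.

End Relabelled.

Ltac relabel H := apply: perm_trans H; apply/seq.permP => ? /=; lia.

(** The sum over pairs becomes [- y i * (y i + y l)]: either [i], [j], [k] all carry 0, or [l]
    carries the same value as [j] and [k]. *)
Lemma three_equal_of_opp i j k l : perm_eq [:: i; j; k; l] (iota 0 4) ->
  y i + y j = 0 -> y i + y k = 0 -> three_equal.
Proof.
move=> ijkl /eqP; rewrite addrC addr_eq0 => /eqP yj /eqP.
rewrite addrC addr_eq0 => /eqP yk; have := sum_pairs_y ijkl; rewrite yj yk.
rewrite (_ : _ + _ = - y i * (y i + y l)); last by ring.
move/eqP; rewrite mulf_eq0 oppr_eq0 => /orP[/eqP yi | ].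
  by apply: (three_equalW ijkl); rewrite yj ?yk // yi oppr0.
rewrite addrC addr_eq0 => /eqP yl.
by apply: (@three_equalW j k l i); rewrite ?yj ?yk ?yl //; relabel ijkl.
Qed.

(** Whichever factors vanish, the two sums share exactly one index. *)
Lemma three_equal_of_two_pairings i j k l : perm_eq [:: i; j; k; l] (iota 0 4) ->
  (y i + y j) * (y k + y l) = 0 -> (y i + y k) * (y j + y l) = 0 -> three_equal.
Proof.
move=> ijkl /eqP; rewrite mulf_eq0 => /orP[] /eqP D /eqP;
  rewrite mulf_eq0 => /orP[] /eqP D'.
- exact: (three_equal_of_opp ijkl).
- by apply: (@three_equal_of_opp j i l k); rewrite // 1?addrC //; relabel ijkl.
- by apply: (@three_equal_of_opp k l i j); rewrite // 1?addrC //; relabel ijkl.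
- by apply: (@three_equal_of_opp l k j i); rewrite // 1?addrC //; relabel ijkl.
Qed.

Lemma three_equal_of_pairing_fix i j k l : perm_eq [:: i; j; k; l] (iota 0 4) ->
  (y i + y j) * (y k + y l) = 0 -> y i * (2 * y i - s) = 0 -> three_equal.
Proof.
move=> ijkl D; have P := pair_products_y ijkl D; have S := sum_yE ijkl.
move/eqP: D; rewrite mulf_eq0 => /orP[] /eqP D /eqP;
  rewrite mulf_eq0 => /orP[] /eqP E.
- have yj : y j = 0 by rewrite -D E add0r.
  move/eqP: P; rewrite E mul0r add0r mulf_eq0 => /orP[]/eqP y0.
    by apply: (three_equalW ijkl); rewrite ?E ?yj ?y0.
  by apply: (@three_equalW i j l k); rewrite ?E ?yj ?y0 //; relabel ijkl.
(* Here [y k + y l = 2 * y i] and [y k * y l = y i ^+ 2], so both equal [y i]. *)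
- have yj : y j = - y i by apply/eqP; rewrite -addr_eq0 addrC D.
  have yl : y l = 2 * y i - y k.
    by apply: (linear_combination3 S D E 1 (-1) (-1)); ring.
  have yk : y k = y i.
    apply/subr0_eq/eqP; rewrite -sqrf_eq0; apply/eqP; rewrite -[RHS]oppr0 -P yj yl.
    by ring.
  by apply: (@three_equalW i k l j); rewrite ?yl ?yk //; [relabel ijkl | ring].
- move/eqP: P; rewrite E mul0r add0r mulf_eq0 => /orP[]/eqP y0;
    move: D; rewrite y0 ?add0r ?addr0 => y0'.
    by apply: (@three_equalW i k l j); rewrite ?E ?y0 ?y0' //; relabel ijkl.
  by apply: (@three_equalW i k l j); rewrite ?E ?y0 ?y0' //; relabel ijkl.
(* Here [y k + y l = 0] and [y k * y l = - y i ^+ 2], so [y i] is a root of the quadratic with roots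
   [y k], [y l]. *)
- have yj : y j = y i by apply: (linear_combination3 S D E 1 (-1) (-1)); ring.
  have: (y k - y i) * (y l - y i) = 0.
    apply: (linear_combination2 P D 1 (- y i)); rewrite yj; ring.
  move/eqP; rewrite mulf_eq0 => /orP[]/eqP/subr0_eq y0.
    by apply: (three_equalW ijkl); rewrite yj ?y0.
  by apply: (@three_equalW i j l k); rewrite ?yj ?y0 //; relabel ijkl.
Qed.

(** The vanishing factor makes [y i + y j] equal to 0 or [s]; with the squared difference 1, the
    3-cycle condition follows at [i] or at [j]. *)
Lemma three_equal_of_pairing_transp i j k l :
  perm_eq [:: i; j; k; l] (iota 0 4) ->
  (y i + y j) * (y k + y l) = 0 -> (y i - y j) ^+ 2 = 1 -> three_equal.
Proof.
move=> ijkl D T; have S := sum_yE ijkl.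
have jikl : perm_eq [:: j; i; k; l] (iota 0 4) by relabel ijkl.
have D' : (y j + y i) * (y k + y l) = 0 by rewrite [y j + _]addrC.
suff: y i * (2 * y i - s) = 0 \/ y j * (2 * y j - s) = 0.
  by case; [exact: three_equal_of_pairing_fix ijkl D
           | exact: three_equal_of_pairing_fix jikl D'].
move/eqP: D; rewrite mulf_eq0 => /orP[] /eqP D.
- have: (2 * y i - s) * (2 * y j - s) = 0.
    by apply: (linear_combination3 sqr_s T D 1 (-1) (y i + y j - 2 * s)); ring.
  by move/eqP; rewrite mulf_eq0 => /orP[] /eqP ->; [left | right]; rewrite mulr0.
- have: y i * y j = 0.
    apply: (linear_combination3 sqr_s T D (1 / 4) (- 1 / 4) (- (s + y i + y j)/4)).
    by rewrite -S; field.
  by move/eqP; rewrite mulf_eq0 => /orP[] /eqP ->; [left | right]; rewrite mul0r.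
Qed.

(** The other coordinates are [y i + u] or [y i - u]; a split of two against one is excluded by
    [no_unbalanced_star], up to relabelling and the sign of [u]. *)
Lemma three_equal_of_star i j k l : perm_eq [:: i; j; k; l] (iota 0 4) ->
  (y i - y j) ^+ 2 = 1 -> (y i - y k) ^+ 2 = 1 -> (y i - y l) ^+ 2 = 1 ->
  three_equal.
Proof.
move=> ijkl; set u := y i - y j => u1 v1 w1.
have yj : y j = y i - u by rewrite /u; ring.
have from_sqr m : (y i - y m) ^+ 2 = 1 -> y m = y i - u \/ y m = y i + u.
  rewrite -u1 => /eqP; rewrite eqf_sqr => /orP[] /eqP e; [left | right].
    by rewrite -e; ring.
  by rewrite -[u]opprK -e; ring.
have nu1 : (- u) ^+ 2 = 1 by rewrite sqrrN.
case: (from_sqr k v1) (from_sqr l w1) => yk [] yl.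
- by apply: (@three_equalW j k l i); rewrite ?yj ?yk ?yl //; relabel ijkl.
- by case: (no_unbalanced_star ijkl u1 yj yk yl).
- by case: (@no_unbalanced_star i j l k _ u) => //; relabel ijkl.
- case: (@no_unbalanced_star i k l j _ (- u)); rewrite ?opprK //; relabel ijkl.
Qed.

Lemma conflict_three_equal rs : {in rs, forall r, autocorr r = 0} ->
  conflict rs -> three_equal.
Proof.
move=> T /hasP[[|i [|j [|k [|l []]]]] //]; rewrite mem_permutations => ijkl.
case/or3P.
- case/hasP=> r /T T0 /(autocorr_id ijkl)/eqP.
  by rewrite T0 eq_sym oner_eq0.
- case/andP=> /hasP[r /T T0 /(autocorr_cyclic ijkl)/(_ T0) D].
  case/or3P=> /hasP[r' /T T0'].
  + have ikjl : perm_eq [:: i; k; j; l] (iota 0 4) by relabel ijkl.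
    move/(autocorr_cyclic ikjl)/(_ T0').
    exact: three_equal_of_two_pairings D.
  + move/(autocorr_cycle3 ijkl)/(_ T0').
    exact: three_equal_of_pairing_fix D.
  + move/(autocorr_transp ijkl)/(_ T0').
    exact: three_equal_of_pairing_transp D.
- have ikjl : perm_eq [:: i; k; j; l] (iota 0 4) by relabel ijkl.
  have jkil : perm_eq [:: j; k; i; l] (iota 0 4) by relabel ijkl.
  have iljk : perm_eq [:: i; l; j; k] (iota 0 4) by relabel ijkl.
  case/andP=> /andP[/hasP[r /T T0 /(autocorr_transp ijkl)/(_ T0) U]].
  case/hasP=> r' /T T0' /(autocorr_transp ikjl)/(_ T0') V.
  case/orP=> /hasP[q /T T1].
    by move/(autocorr_transp jkil)/(_ T1) => W; case: (triangle_transp U V W).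
  move/(autocorr_transp iljk)/(_ T1); exact: three_equal_of_star U V.
Qed.

End Coordinates.

(** * Orthogonal matrices and matching of rows *)

Section Orthogonal.
Variable R : comNzRingType.

Lemma orthogonal_mulmx n (A B : 'M[R]_n) :
  A^T *m A = 1%:M -> B^T *m B = 1%:M -> (A *m B)^T *m (A *m B) = 1%:M.
Proof.
by move=> hA hB; rewrite trmx_mul mulmxA -(mulmxA B^T) hA mulmx1.
Qed.

Lemma orthogonal_perm_mx n (s : 'S_n) :
  (perm_mx s : 'M[R]_n)^T *m perm_mx s = 1%:M.
Proof. by rewrite tr_perm_mx -perm_mxM mulVg perm_mx1. Qed.

Lemma orthogonal_row_inj n (A : 'M[R]_n) :
  A^T *m A = 1%:M -> injective (fun i => row i A).
Proof.
move=> /mulmx1C hA i j /= /(congr1 (mulmx^~ A^T)); rewrite -!row_mul hA.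
move=> /rowP/(_ i); rewrite !mxE eqxx => /eqP.
by case: (eqVneq j i) => // _; rewrite oner_eq0.
Qed.

Lemma one_oplus_P3_perm (Pb : 'M[R]_4) :
  one_oplus_P3 R Pb -> exists s : 'S_4, Pb = perm_mx s.
Proof.
case=> P /is_perm_mxP[s ->] ->; exists (lift0_perm s).
by rewrite -lift0_mx_perm.
Qed.

(** The rows of [A] are distinct and its row 0 is already matched, so the lower rows map injectively
    to lower rows of [B], which gives a permutation of three indices. *)
Lemma one_oplus_P3_of_rows (A B : 'M[R]_4) : A^T *m A = 1%:M ->
  row 0 A = row 0 B -> (forall i, exists j, row i A = row j B) ->
  exists2 Pb, one_oplus_P3 R Pb & A = Pb *m B.
Proof.
move=> /orthogonal_row_inj injA row0 rowAB.
have lower (i : 'I_3) : exists k : 'I_3, row (lift 0 i) A = row (lift 0 k) B.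
  have [j] := rowAB (lift 0 i); case: (unliftP 0 j) => [k ->|->]; first by exists k.
  by rewrite -row0 => /injA.
have [g gP] := fin_all_exists lower.
have injg : injective g.
  by move=> i j gij; apply: (@lift_inj _ 0); apply: injA; rewrite /= !gP gij.
exists (perm_mx (lift0_perm (perm injg))).
  exists (perm_mx (perm injg)); first exact: perm_mx_is_perm.
  by rewrite -lift0_mx_perm.
apply/row_matrixP => i; rewrite -row_permE.
have -> : row i (row_perm (lift0_perm (perm injg)) B) =
          row (lift0_perm (perm injg) i) B by apply/rowP => j; rewrite !mxE.
case: (unliftP 0 i) => [k|] ->; last by rewrite lift0_perm0.
by rewrite lift0_perm_lift permE gP.
Qed.

End Orthogonal.

(** * The cyclic pattern common to M and N *)

Definition cyclic_rows : seq (seq nat) :=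
  [:: [:: 0; 1; 2; 3]; [:: 1; 0; 3; 2]; [:: 2; 3; 1; 0]; [:: 3; 2; 0; 1]]%N.

(** [cyclic_rows] lists the powers of the 4-cycle 0, 2, 1, 3, in the row order of the blocks M and
    N. *)
Definition cyclic_mx (R : Type) (z : nat -> R) : 'M[R]_4 :=
  \matrix_(i, j) z (nth 0%N (nth [::] cyclic_rows i) j).

Lemma block_mx22E (R : Type) (A B C D : 'M[R]_2) (i j : 'I_4) :
  (block_mx A B C D : 'M_(2 + 2)) i j =
  if (i < 2)%N
  then if (j < 2)%N then A (inord i) (inord j) else B (inord i) (inord (j - 2))
  else if (j < 2)%N then C (inord (i - 2)) (inord j)
  else D (inord (i - 2)) (inord (j - 2)).
Proof.
rewrite /block_mx !mxE.
by case: (@splitP 2 2 i) => k ->; rewrite !mxE; case: (@splitP 2 2 j) => l ->;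
  rewrite ?ltn_ord ?ltnNge ?leq_addr /= ?addKn ?inord_val.
Qed.

Ltac entries := case=> [[|[|[|[|//]]]] /= ?]; case=> [[|[|[|[|//]]]] /= ?].

Section Pattern.
Variable F : numFieldType.
Implicit Types (z : nat -> F) (b : bool).

Lemma Mmx_cyclic b (x w : F) :
  Mmx b x w = cyclic_mx (nth 0 [:: x; - x; w; (-1) ^+ b - w]).
Proof.
by apply/matrixP; entries;
  rewrite /Mmx block_mx22E !mxE /= -?val_eqE /= ?inordK //= ?opprK.
Qed.

Lemma Nmx_cyclic b (x w : F) :
  Nmx b w x = cyclic_mx (nth 0 [:: w; (-1) ^+ b - w; x; - x]).
Proof.
apply/matrixP; entries; rewrite /Nmx block_mx22E !mxE /=;
  rewrite ?big_ord_recl ?big_ord0 ?mxE -?val_eqE /= ?inordK //=;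
  rewrite ?mul0r ?mul1r ?add0r ?addr0 //.
Qed.

(** Columns 0 and 1, and columns 2 and 3, have inner product [2 * (z 0 * z 1 + z 2 * z 3)]; any
    other two distinct columns have [(z 0 + z 1) * (z 2 + z 3)]. *)
Lemma cyclic_mx_orthogonal z :
  \sum_(u <- iota 0 4) z u ^+ 2 = 1 -> (z 0 + z 1) * (z 2 + z 3) = 0 ->
  z 0 * z 1 + z 2 * z 3 = 0 ->
  (cyclic_mx z)^T *m cyclic_mx z = 1%:M.
Proof.
rewrite /= !big_cons big_nil => Q D E.
apply/matrixP; entries; rewrite !mxE !big_ord_recl big_ord0 !mxE -val_eqE /=.
all: first [ by apply: (linear_combination2 Q D 1 0); ring
           | by apply: (linear_combination2 D E 1 0); ring
           | by apply: (linear_combination2 D E 0 2); ring ].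
Qed.

Lemma cyclic_mx_block z s : \sum_(u <- iota 0 4) z u = s ->
  \sum_(u <- iota 0 4) z u ^+ 2 = 1 -> s ^+ 2 = 1 ->
  (z 0 + z 1) * (z 2 + z 3) = 0 ->
  exists b x w, x ^+ 2 + w ^+ 2 - (-1) ^+ b * w = 0 /\
    (cyclic_mx z = Mmx b x w \/ cyclic_mx z = Nmx b w x).
Proof.
move=> S Q s1 D; have P := pair_products_y S Q s1 (perm_refl _) D.
have [b sb] : exists b : bool, s = (-1) ^+ b.
  move/eqP: s1; rewrite sqrf_eq1 => /orP[]/eqP ->; [by exists false | by exists true].
move: S; rewrite /= !big_cons big_nil sb => S.
move/eqP: D; rewrite mulf_eq0 => /orP[] /eqP D.
(* With [z 1 = - z 0] and [z 3 = (-1) ^+ b - z 2], the relation [P] is the equation of the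
   parameters; the other factor exchanges the two pairs and gives N. *)
- exists b, (z 0), (z 2); split.
    apply: (linear_combination3 S D P (z 2) (z 0 - z 2) (-1)); ring.
  left; rewrite Mmx_cyclic; apply/matrixP; entries; rewrite !mxE /= //;
  first [ by apply: (linear_combination2 S D 0 1); ring
        | by apply: (linear_combination2 S D 1 (-1)); ring ].
- exists b, (z 2), (z 0); split.
    apply: (linear_combination3 S D P (z 0) (z 2 - z 0) (-1)); ring.
  right; rewrite Nmx_cyclic; apply/matrixP; entries; rewrite !mxE /= //;
  first [ by apply: (linear_combination2 S D 0 1); ring
        | by apply: (linear_combination2 S D 1 (-1)); ring ].
Qed.

Lemma block_orthogonal b (x w : F) : x ^+ 2 + w ^+ 2 - (-1) ^+ b * w = 0 ->
  (Mmx b x w)^T *m Mmx b x w = 1%:M /\ (Nmx b w x)^T *m Nmx b w x = 1%:M.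
Proof.
have := sqrr_sign F b; set e := (-1) ^+ b => e1 H.
rewrite Mmx_cyclic Nmx_cyclic; split; apply: cyclic_mx_orthogonal;
  rewrite /= ?big_cons ?big_nil -/e /=.
all: try ring.
all: try by apply: (linear_combination2 H e1 2 1); ring.
all: by apply: (linear_combination2 H e1 (-1) 0); ring.
Qed.

End Pattern.

(** * One-line notations as the link between permutations and the finite check *)

Definition perm_code (t : 'S_4) : seq nat := [seq val (t (inord u)) | u <- iota 0 4].

Lemma nth_perm_code (t : 'S_4) (j : 'I_4) : nth 0%N (perm_code t) j = t j.
Proof. by rewrite (nth_map 0%N) ?size_iota // nth_iota // inord_val. Qed.

Lemma perm_code_iota (t : 'S_4) : perm_eq (perm_code t) (iota 0 4).
Proof.
have uc : uniq (perm_code t).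
  rewrite map_inj_in_uniq ?iota_uniq // => u v; rewrite !mem_iota /= => u4 v4.
  by move/val_inj/perm_inj/(congr1 val); rewrite /= !inordK.
apply: uniq_perm => //.
have sub : {subset perm_code t <= iota 0 4}.
  by move=> _ /mapP[u _ ->]; rewrite mem_iota ltn_ord.
by case: (uniq_min_size uc sub _) => [|_]; rewrite ?size_map.
Qed.

Lemma perm_code1 : perm_code 1%g = iota 0 4.
Proof. by rewrite /perm_code /= !permE !inordK. Qed.

Lemma perm_code_tperm12 : perm_code (tperm (inord 1) (inord 2)) = [:: 0; 2; 1; 3]%N.
Proof. by rewrite /perm_code /= !permE /= -!val_eqE /= !inordK /= ?inordK. Qed.

Lemma perm_code_tperm13 : perm_code (tperm (inord 1) (inord 3)) = [:: 0; 3; 2; 1]%N.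
Proof. by rewrite /perm_code /= !permE /= -!val_eqE /= !inordK /= ?inordK. Qed.

Lemma sum_reindex (V : nmodType) (p : seq nat) (g : nat -> V) : p \in perms4 ->
  \sum_(j < 4) g (nth 0%N p j) = \sum_(u <- iota 0 4) g u.
Proof.
rewrite mem_permutations => pP; rewrite -(perm_big _ pP) /=.
by rewrite (big_nth 0%N) (perm_size pP) big_mkord.
Qed.

Lemma rel_perm_iota q : q \in perms4 -> rel_perm (iota 0 4) q = q.
Proof.
have : all (fun r => rel_perm (iota 0 4) r == r) perms4 by vm_compute.
by move/allP => h /h /eqP.
Qed.

(** Substituting [u = nth 0 p j] identifies the inner product of two rows with an
    autocorrelation. *)
Lemma autocorr_rel_perm (F : numFieldType) (y : nat -> F) p q : p \in perms4 ->
  autocorr y (rel_perm p q) = \sum_(j < 4) y (nth 0%N p j) * y (nth 0%N q j).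
Proof.
move=> pP; have := pP; rewrite mem_permutations => pe.
have -> : autocorr y (rel_perm p q) =
    \sum_(u <- iota 0 4) y u * y (nth 0%N q (index u p)).
  by rewrite /autocorr /= !big_cons !big_nil.
rewrite -(sum_reindex (fun u => y u * y (nth 0%N q (index u p))) pP).
apply: eq_bigr => j _; rewrite index_uniq //; first by rewrite (perm_size pe).
by rewrite (perm_uniq pe) iota_uniq.
Qed.

(** Transitivity of the cyclic group: when all coordinates but that of [m] agree, a row depends only
    on where [m] stands in it. *)
Lemma cyclic_row_of_position m p : (m < 4)%N -> p \in perms4 ->
  exists2 c, c \in cyclic_rows &
    forall u, (u < 4)%N -> (nth 0%N p u == m) = (nth 0%N c u == m).
Proof.
have : all (fun m => all (fun p => has (fun c => all (fun u =>
    (nth 0%N p u == m) == (nth 0%N c u == m)) (iota 0 4)) cyclic_rows) perms4)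
    (iota 0 4) by vm_compute.
move=> /allP h m4 pP; have /h /allP/(_ _ pP)/hasP[c cc /allP hc] : m \in iota 0 4.
  by rewrite mem_iota.
by exists c => // u u4; have := hc u; rewrite mem_iota => /(_ u4)/eqP.
Qed.

Lemma cyclic_rows_lt c (u : nat) :
  c \in cyclic_rows -> (u < 4)%N -> (nth 0%N c u < 4)%N.
Proof.
move=> cc u4; have : all (all (gtn 4)) cyclic_rows by [].
by move/allP/(_ _ cc)/all_nthP; apply; move: cc; rewrite !inE => /or4P[]/eqP->.
Qed.

Lemma perms4_lt p (u : nat) : p \in perms4 -> (u < 4)%N -> (nth 0%N p u < 4)%N.
Proof.
rewrite mem_permutations => pe u4.
have : nth 0%N p u \in iota 0 4.
  by rewrite -(perm_mem pe) mem_nth // (perm_size pe).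
by rewrite mem_iota.
Qed.

(** Relabelling by [[:: i; j; k; l]] conjugates [p] into the standard cyclic group. *)
Lemma is_cyclic_row i j k l p : is_cyclic i j k l p ->
  exists2 c, c \in cyclic_rows & [seq nth 0%N p u | u <- [:: i; j; k; l]] =
    [seq nth 0%N [:: i; j; k; l] u | u <- c].
Proof.
by case/or3P => /eqP ->; [exists [:: 1; 0; 3; 2]%N | exists [:: 2; 3; 1; 0]%N
  | exists [:: 3; 2; 0; 1]%N].
Qed.

(** * From orthogonality to the three families *)

Section Forward.
Variables (F : numFieldType) (x : 'rV[F]_4) (p : 'I_4 -> 'S_4).
Hypothesis p0 : p 0 = 1%g.
Let A : 'M[F]_4 := \matrix_(i, j) x 0 (p i j).
Hypothesis orthA : A^T *m A = 1%:M.
Let y (u : nat) : F := x 0 (inord u).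
Let c (i : 'I_4) := perm_code (p i).
Let s : F := \sum_(u <- iota 0 4) y u.

Let cP i : c i \in perms4.
Proof. by rewrite mem_permutations perm_code_iota. Qed.

Let AE i j : A i j = y (nth 0%N (c i) j).
Proof. by rewrite mxE nth_perm_code /y inord_val. Qed.

Let gram i j : \sum_(u < 4) y (nth 0%N (c i) u) * y (nth 0%N (c j) u) = (i == j)%:R.
Proof.
have /matrixP/(_ i j) := mulmx1C orthA; rewrite !mxE => <-.
by apply: eq_bigr => u _; rewrite [A^T u j]mxE !AE.
Qed.

Let sum_sqr : \sum_(u <- iota 0 4) y u ^+ 2 = 1.
Proof.
rewrite -(sum_reindex (fun u => y u ^+ 2) (cP 0)).
by have := gram 0 0; rewrite eqxx mulr1n => <-.
Qed.

(* The all-ones vector is an eigenvector of A for s, and A is orthogonal. *)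
Let sqr_s : s ^+ 2 = 1.
Proof.
pose o : 'cV[F]_4 := const_mx 1.
have Ao : A *m o = s *: o.
  apply/matrixP => i j; rewrite !mxE mulr1 /s -(sum_reindex y (cP i)).
  by apply: eq_bigr => u _; rewrite [o u j]mxE mulr1 AE.
have : (A *m o)^T *m (A *m o) = o^T *m o.
  by rewrite trmx_mul mulmxA -(mulmxA o^T) orthA mulmx1.
have -> : (A *m o)^T = s *: o^T by rewrite Ao linearZ.
rewrite Ao -scalemxAl -scalemxAr scalerA -expr2.
move/matrixP/(_ 0 0); rewrite !mxE.
have -> : \sum_j o^T 0 j * o j 0 = 4.
  by under eq_bigr do rewrite !mxE mulr1; rewrite sumr_const card_ord.
by move/(canRL (mulfK _)) => ->; rewrite ?divff // pnatr_eq0.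
Qed.

Let autocorr0 i j : i != j -> autocorr y (rel_perm (c i) (c j)) = 0.
Proof. by move=> /negPf ij; rewrite autocorr_rel_perm // gram ij. Qed.

Let autocorr_row i : i != 0 -> autocorr y (c i) = 0.
Proof.
move=> i0; rewrite -(rel_perm_iota (cP i)) -perm_code1 -p0.
by apply: autocorr0; rewrite eq_sym.
Qed.

(** Row matching applies to [A *m perm_mx t] and [perm_mx t *m cyclic_mx z], whose first rows agree
    as [t] fixes 0; the involution [t] is then moved back to the right. *)
Lemma conjugate_block (t : 'S_4) : t 0 = 0 -> (t * t)%g = 1%g ->
  let z u := y (nth 0%N (perm_code t) u) in
  (z 0%N + z 1%N) * (z 2%N + z 3%N) = 0 ->
  (forall i, exists2 r, r \in cyclic_rows &
     forall u : 'I_4, A i (t u) = z (nth 0%N r u)) ->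
  exists (Pb : 'M[F]_4) (b : bool) (v w : F),
  [/\ one_oplus_P3 F Pb, v ^+ 2 + w ^+ 2 - (-1) ^+ b * w = 0 &
    A = Pb *m perm_mx t *m Mmx b v w *m perm_mx t \/
    A = Pb *m perm_mx t *m Nmx b w v *m perm_mx t].
Proof.
move=> t0 tt z D rows.
have tK : t^-1%g = t by apply: (mulgI t); rewrite mulgV.
have tP : perm_code t \in perms4 by rewrite mem_permutations perm_code_iota.
have TT : perm_mx t *m perm_mx t = 1%:M :> 'M[F]_4 by rewrite -perm_mxM tt perm_mx1.
have sum_z (f : F -> F) : \sum_(u <- iota 0 4) f (z u) = \sum_(u <- iota 0 4) f (y u).
  rewrite -(sum_reindex (f \o y) tP) -(sum_reindex (f \o z) (cP 0)) /=.
  by apply: eq_bigr => u _; rewrite /c p0 perm_code1 nth_iota.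
have sum_sqr_z := etrans (sum_z (fun a => a ^+ 2)) sum_sqr.
have [b [v [w [H MN]]]] := cyclic_mx_block (sum_z id) sum_sqr_z sqr_s D.
have ATE i u : (A *m perm_mx t) i u = A i (t u).
  by rewrite -[t in perm_mx t]invgK -col_permE !mxE tK.
have [||i|Pb PbP AT] :=
  @one_oplus_P3_of_rows F (A *m perm_mx t) (perm_mx t *m cyclic_mx z).
- exact: orthogonal_mulmx orthA (orthogonal_perm_mx F t).
- apply/rowP => u; rewrite mxE ATE -row_permE !mxE t0 p0 perm1.
  rewrite -[nth [::] cyclic_rows 0]/(iota 0 4) nth_iota //.
  by rewrite /z nth_perm_code /y inord_val.
- have [r rr hr] := rows i.
  have r4 : (index r cyclic_rows < 4)%N by rewrite index_mem.
  exists (t (Ordinal r4)); apply/rowP => u; rewrite mxE ATE hr -row_permE !mxE.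
  by rewrite -permM tt perm1 /= nth_index.
have AE' : A = Pb *m perm_mx t *m cyclic_mx z *m perm_mx t.
  by rewrite -[A in LHS]mulmx1 -TT mulmxA AT !mulmxA.
exists Pb, b, v, w; split=> //.
by case: MN => <-; [left | right].
Qed.

Let cyclic_case (t : 'S_4) i j k l : perm_code t = [:: i; j; k; l] ->
  (forall a, a != 0 -> is_cyclic i j k l (c a)) ->
  let z u := y (nth 0%N (perm_code t) u) in
  (z 0%N + z 1%N) * (z 2%N + z 3%N) = 0 /\
  (forall a, exists2 r, r \in cyclic_rows &
     forall u : 'I_4, A a (t u) = z (nth 0%N r u)).
Proof.
move=> tE cyc z; split.
  rewrite /z tE /=; have ijkl := perm_code_iota t; rewrite tE in ijkl.
  (* Row 1; any row other than row 0 would give the same factorization. *)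
  have n0 : lift 0 0 != 0 :> 'I_4 by [].
  exact: (autocorr_cyclic (erefl s) sum_sqr sqr_s ijkl (cyc _ n0) (autocorr_row n0)).
have Az a (u : 'I_4) :
    A a (t u) = y (nth 0%N [seq nth 0%N (c a) v | v <- perm_code t] u).
  by rewrite (nth_map 0%N) ?size_map // nth_perm_code AE.
move=> a; have [->|a0] := eqVneq a 0.
  exists (iota 0 4) => // u.
  by rewrite AE /c p0 perm_code1 /z !nth_iota // nth_perm_code.
have [r rr e] := is_cyclic_row (cyc a a0); exists r => // u.
rewrite Az tE e (nth_map 0%N) ?/z ?tE //.
by move: rr; rewrite !inE => /or4P[]/eqP->; rewrite ltn_ord.
Qed.

Let three_equal_case : three_equal y ->
  (y 0%N + y 1%N) * (y 2%N + y 3%N) = 0 /\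
  (forall a, exists2 r, r \in cyclic_rows &
     forall u : 'I_4, A a u = y (nth 0%N r u)).
Proof.
case=> m m4 [d yd]; split.
  (* If [e] is the coordinate at [m], the sum over pairs is [3 * d * (d + e)] and the product is
     [2 * d * (d + e)], hence the factor 2/3. *)
  have := sum_pairs_y (erefl s) sum_sqr sqr_s (perm_refl _).
  case: m m4 yd => [|[|[|[|//]]]] _ yd;
    [ rewrite !(yd 1%N, yd 2%N, yd 3%N) // | rewrite !(yd 0%N, yd 2%N, yd 3%N) //
    | rewrite !(yd 0%N, yd 1%N, yd 3%N) // | rewrite !(yd 0%N, yd 1%N, yd 2%N) // ]
    => P;
    by apply: (linear_combination2 P P (2 / 3) 0); field.
move=> a; have [r rr hr] := cyclic_row_of_position m4 (cP a); exists r => // u.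
rewrite AE; have := hr u (ltn_ord u).
case: eqVneq => [-> /esym/eqP -> // | nm /esym/negbT nm'].
by rewrite (yd (nth 0%N (c a) u)) ?perms4_lt // (yd (nth 0%N r u)) ?cyclic_rows_lt.
Qed.

Lemma orthogonal_rows_in_union : (calX F `|` calY F `|` calZ F)%classic A.
Proof.
pose i1 : 'I_4 := lift 0 (@Ordinal 3 0 isT).
pose i2 : 'I_4 := lift 0 (@Ordinal 3 1 isT).
pose i3 : 'I_4 := lift 0 (@Ordinal 3 2 isT).
have all_rows i j k l : all (is_cyclic i j k l) [:: c i1; c i2; c i3] ->
    forall a, a != 0 -> is_cyclic i j k l (c a).
  rewrite /= andbT => /and3P[h1 h2 h3] a; case: (unliftP 0 a) => [b|] -> // _.
  by case: b => [[|[|[|//]]]] b3; rewrite (bool_irrelevance b3 isT).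
have id_case : (y 0%N + y 1%N) * (y 2%N + y 3%N) = 0 ->
  (forall a, exists2 r, r \in cyclic_rows &
     forall u : 'I_4, A a u = y (nth 0%N r u)) -> calX F A.
  move=> D rows; have [||||Pb [b [v [w []]]]] := @conjugate_block 1%g.
  - by rewrite perm1.
  - by rewrite mulg1.
  - by rewrite perm_code1.
  - move=> a; have [r rr hr] := rows a; exists r => // u; rewrite perm1 hr.
    rewrite perm_code1 nth_iota // cyclic_rows_lt //.
  by rewrite perm_mx1 !mulmx1; exists Pb, b, v, w.
have := conflict_or_same_cyclic.
move=> /allP/(_ _ (cP i1))/allP/(_ _ (cP i2))/allP/(_ _ (cP i3))/orP[].
  (* Any of the three groups would serve when three coordinates coincide; the choice made is
     [calX]. *)
  move/conflict_three_equal => h; left; left.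
  case: (three_equal_case (h _ _ _ (erefl s) sum_sqr sqr_s _)) => //.
  move=> r; rewrite !inE; do 5?[case/orP]; move/eqP=> ->;
    first [exact: autocorr_row | exact: autocorr0].
case/or3P => /all_rows cyc.
- left; left; have [D rows] := cyclic_case perm_code1 cyc.
  apply: id_case => [|a].
    by move: D; rewrite perm_code1.
  have [r rr hr] := rows a; exists r => // u; have := hr u.
  by rewrite perm1 perm_code1 nth_iota // cyclic_rows_lt.
- left; right; have [D rows] := cyclic_case perm_code_tperm12 cyc.
  have [||Pb [b [v [w []]]]] := conjugate_block _ _ D rows.
  + by rewrite tpermD // -val_eqE /= inordK.
  + exact: tperm2.
  by exists Pb, b, v, w.
- right; have [D rows] := cyclic_case perm_code_tperm13 cyc.
  have [||Pb [b [v [w []]]]] := conjugate_block _ _ D rows.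
  + by rewrite tpermD // -val_eqE /= inordK.
  + exact: tperm2.
  by exists Pb, b, v, w.
Qed.

End Forward.

(** * From the three families to orthogonality, and the equivalence *)

Section Converse.
Variable F : numFieldType.

Lemma union_orthogonal (A : 'M[F]_4) : (calX F `|` calY F `|` calZ F)%classic A ->
  A^T *m A = 1%:M.
Proof.
have conj_orth (t : 'S_4) Pb (B : 'M[F]_4) : one_oplus_P3 F Pb -> B^T *m B = 1%:M ->
    let C := Pb *m perm_mx t *m B *m perm_mx t in C^T *m C = 1%:M.
  move=> /one_oplus_P3_perm[u ->] B1.
  by do 3?[apply: orthogonal_mulmx => //]; apply: orthogonal_perm_mx.
have conj_orth1 Pb (B : 'M[F]_4) : one_oplus_P3 F Pb -> B^T *m B = 1%:M ->
    (Pb *m B)^T *m (Pb *m B) = 1%:M.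
  by move=> PbP B1; have := conj_orth 1%g _ _ PbP B1; rewrite perm_mx1 !mulmx1.
by case=> [[]|] [Pb [b [x [w [PbP /block_orthogonal[M1 N1] []->]]]]];
  [exact: conj_orth1 | exact: conj_orth1 | exact: conj_orth | exact: conj_orth
  | exact: conj_orth | exact: conj_orth].
Qed.

End Converse.

Lemma permutative_of_perm_rows (R : nzRingType) n (x : 'rV[R]_n) (p : 'I_n -> 'S_n)
  (A : 'M[R]_n) : (forall i, row i A = col_perm (p i) x) -> permutative A.
Proof.
move=> rowA i j; exists (p i * (p j)^-1)%g.
by rewrite !rowA -col_permM mulgKV.
Qed.

Theorem theorem2p1 (K : realType) (x : 'rV[K[i]]_4) (P Q R : 'M[K[i]]_4)
    (hP : is_perm_mx P) (hQ : is_perm_mx Q) (hR : is_perm_mx R) :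
  OPM (mxrows4 x P Q R) <->
  (calX K[i] `|` calY K[i] `|` calZ K[i]) (mxrows4 x P Q R).
Proof.
case/is_perm_mxP: hP => sP ->; case/is_perm_mxP: hQ => sQ ->.
case/is_perm_mxP: hR => sR ->.
set A := mxrows4 _ _ _ _.
(* Inverses appear because entry [j] of [x *m perm_mx s] is the entry of [x] at the preimage of [j]
   under [s]. *)
pose p (i : 'I_4) : 'S_4 := nth 1%g [:: 1%g; sP^-1%g; sQ^-1%g; sR^-1%g] i.
have rowA i : row i A = col_perm (p i) x.
  apply/rowP => j; rewrite !mxE; case: i => [[|[|[|[|//]]]] i4] /=;
    by rewrite ?perm1 // -[s in perm_mx s]invgK -col_permE mxE.
have AE : A = \matrix_(i, j) x 0 (p i j).
  by apply/matrixP => i j; have /rowP/(_ j) := rowA i; rewrite !mxE.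
split=> [[_ orthA] | /union_orthogonal orthA].
  by rewrite AE; apply: orthogonal_rows_in_union; rewrite -?AE.
by split=> //; apply: permutative_of_perm_rows rowA.
Qed.
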